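(* Let $\mathcal{G}$ be a weakly logarithmic class of assemblies with parameters $\rho,\Theta,\theta,\theta'>0$ and $n_0\ge 1$. There is a constant $C>0$, depending only on $\rho,\Theta,\theta,\theta',n_0$, such that for every $n\ge1$ and every completely additive function $h:\mathcal{G}_n\to\mathbb{R}$, i.e. $h(\sigma)=\sum_{j=1}^n a_j k_j(\sigma)$ with arbitrary real $a_1,\dots,a_n$, $$\mathbf{V}_n h\le C\sum_{j=1}^n\lambda_j a_j^2\,\frac{Q(n-j)}{Q(n)}.$$
   Context: An assembly on a finite set is a partition of the set into blocks (components) together with a choice of one of finitely many structures on each block; for a block of size $j$ there are $g_j<\infty$ possible structures (the $g_j\ge 0$ are fixed integers characterizing the class $\mathcal{G}$). $\mathcal{G}_n$ is the set of assemblies on an $n$-element set. Put $\lambda_j=g_j/j!$. For $\bar s=(s_1,\dots,s_n)\in\mathbb{N}_0^n$ let $\ell(\bar s)=1s_1+2s_2+\cdots+ns_n$. Define $$Q(n)=\sum_{\ell(\bar s)=n}\prod_{i=1}^n\frac{\lambda_i^{s_i}}{s_i!},$$ with $Q(0)=1$. The number of assemblies in $\mathcal{G}_n$ is $G(n)=n!\,Q(n)$. The class $\mathcal{G}$ is weakly logarithmic if there are constants $\rho,\Theta,\theta,\theta'>0$ and $n_0\ge1$ such that: (i) $\rho^j j\lambda_j\le\Theta$ for all $j\ge1$; (ii) $\sum_{j\le n}\rho^j j\lambda_j\ge\theta n$ for all $n\ge n_0$; (iii) $nQ(n)\rho^n\ge\theta'\exp\{\sum_{j\le n}\lambda_j\rho^j\}$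 for all $n\ge1$. For $\sigma\in\mathcal{G}_n$ and $1\le j\le n$, $k_j(\sigma)\ge0$ denotes the number of components of size $j$ in $\sigma$. $\mathbf{E}_n$ and $\mathbf{V}_n$ denote expectation and variance with respect to the uniform probability measure on $\mathcal{G}_n$: $\mathbf{V}_n h=\frac{1}{G(n)}\sum_{\sigma\in\mathcal{G}_n}(h(\sigma)-\mathbf{E}_n h)^2$. *)

(* Defs.v *)
From Stdlib Require Import Reals.
From mathcomp Require Import all_boot.
Unset Implicit Arguments. Unset Printing Implicit Defensive.

Local Open Scope R_scope.

Definition sumR {T} (s : seq T) (f : T -> R) : R := foldr (fun x acc => f x + acc) 0 s.
Definition prodR {T} (s : seq T) (f : T -> R) : R := foldr (fun x acc => f x * acc) 1 s.

Definition lam (g : nat -> nat) (j : nat) : R := INR (g j) / INR (j`!).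

(* ell(s) = 1 s_1 + ... + n s_n ; index i : 'I_n stands for i+1 *)
Definition ell n (s : {ffun 'I_n -> 'I_n.+1}) : nat := (\sum_(i < n) i.+1 * s i)%N.

(* Q(n) = sum_{ell(s)=n} prod_i lambda_i^{s_i}/s_i!  (s_i <= n automatically) *)
Definition Q (g : nat -> nat) (n : nat) : R :=
  sumR (enum [pred s : {ffun 'I_n -> 'I_n.+1} | ell n s == n])
       (fun s => prodR (enum 'I_n)
          (fun i => (lam g i.+1) ^ (s i) / INR ((s i)`!))).

Definition Kmax (g : nat -> nat) (n : nat) : nat := (\max_(j < n.+1) g j)%N.

(* Raw data: a set of blocks and a structure label for each subset. *)
Definition raw_asm (g : nat -> nat) (n : nat) : finType :=
  ({set {set 'I_n}} * {ffun {set 'I_n} -> 'I_(Kmax g n).+1})%type.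

(* An assembly on 'I_n: a partition P of 'I_n into (nonempty) blocks together
   with a structure f B < g_{|B|} on each block B; labels of non-blocks are
   fixed to 0 so that assemblies correspond bijectively to these data. *)
Definition is_assembly (g : nat -> nat) (n : nat) (x : raw_asm g n) : bool :=
  partition x.1 [set: 'I_n] &&
  [forall B : {set 'I_n},
     if B \in x.1 then (nat_of_ord (x.2 B) < g #|B|)%N
     else (nat_of_ord (x.2 B) == 0)%N].

Definition Gn (g : nat -> nat) (n : nat) : seq (raw_asm g n) :=
  enum [pred x : raw_asm g n | is_assembly g n x].

Definition kj (g : nat -> nat) (n : nat) (j : nat) (x : raw_asm g n) : nat :=
  #|[set B in x.1 | #|B| == j]|.

Definition En (g : nat -> nat) (n : nat) (h : raw_asm g n -> R) : R :=
  / INR (size (Gn g n)) * sumR (Gn g n) h.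
Definition Vn (g : nat -> nat) (n : nat) (h : raw_asm g n -> R) : R :=
  / INR (size (Gn g n)) * sumR (Gn g n) (fun x => (h x - En g n h) ^ 2).

Definition sum1n (n : nat) (F : nat -> R) : R := sumR (iota 1 n) F.

Definition weakly_log (g : nat -> nat) (rho Theta theta theta' : R) (n0 : nat) : Prop :=
  (forall j : nat, (1 <= j)%nat -> rho ^ j * INR j * lam g j <= Theta) /\
  (forall n : nat, (n0 <= n)%nat ->
      sum1n n (fun j => rho ^ j * INR j * lam g j) >= theta * INR n) /\
  (forall n : nat, (1 <= n)%nat ->
      INR n * Q g n * rho ^ n >= theta' * exp (sum1n n (fun j => lam g j * rho ^ j))).

Definition cadd (g : nat -> nat) (n : nat) (a : nat -> R) (x : raw_asm g n) : R :=
  sum1n n (fun j => a j * INR (kj g n j x)).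

(* Main.v *)
(* The component counts of a uniform random assembly are independent Poisson
   variables xi_j of means lambda_j (or lambda_j rho^j) conditioned on
   sum_j j xi_j = n. Weighting by n = sum_j j xi_j gives
     n W_n(phi) = sum_j j lambda_j W_(n-j)(phi(. + a_j)),
   where W_m(phi) is the unnormalised mean of phi(h) on the event
   sum_j j xi_j = m.
   Split h = h1 + h2 according to 2j <= n and 2j > n. An assembly has at most
   one component larger than n/2, so E h2^2 is exactly the part 2j > n of the
   right-hand side. For h1, centred at A = sum_j a_j lambda_j rho^j, the
   recursion and j lambda_j rho^j <= Theta give
     n W_n((h1 - A)^2) <= 2 Theta sum_(m < n) W_m((h1 - A)^2) + 2 n sum_j lambda_j a_j^2 Q(n-j),
   the first sum being at most the unconditioned Poisson variance times
   exp(Lambda_n), with Lambda_n = sum_(j <= n) lambda_j rho^j; finally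
   exp(Lambda_n) / n is at most a constant times rho^(n-j) Q(n-j) for 2j <= n
   by the lower bound (iii). *)
Require Import Defs.
From Stdlib Require Import Reals.
From mathcomp Require Import all_boot all_order all_algebra ring lra zify.
From mathcomp Require Import Rstruct Rstruct_topology.
From mathcomp Require Import boolp filter topology normedtype reals sequences exp.
Import Order.TTheory GRing.Theory Num.Theory numFieldNormedType.Exports.

(** * Weighted sums over component-count vectors of fixed total size *)

Section CountSums.
Local Open Scope classical_set_scope.
Local Open Scope ring_scope.
Variable (R : realType).
Implicit Types (lam a : nat -> R) (phi : R -> R) (N k m : nat).

(* csum lam a N k m phi is the sum, over s_1, ..., s_k <= N with
   1 s_1 + ... + k s_k = m, of prod_j (lam_j^s_j / s_j!) phi(sum_j a_j s_j);
   the truncation N is immaterial as soon as m <= N (csum_indep). *)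
Fixpoint csum lam a N k m phi : R :=
  if k is k'.+1 then
    \sum_(0 <= s < N.+1 | (k * s <= m)%N)
      lam k ^+ s / s`!%:R * csum lam a N k' (m - k * s) (fun y => phi (y + a k * s%:R))
  else (m == 0)%:R * phi 0.

(** Induction on [k], writing [m] as [(m - k.+1 * s) + k.+1 * s]: the first summand is handled by
    the induction hypothesis and gives the indices up to [k]. In the second, the factor [s] cancels
    against [s!] and lowers [s] by one, which is the term of index [k.+1]. *)
Lemma csum_rec lam a N k m phi : (m <= N)%N ->
  m%:R * csum lam a N k m phi =
  \sum_(1 <= j < k.+1 | (j <= m)%N)
    j%:R * lam j * csum lam a N k (m - j) (fun y => phi (y + a j)).
Proof.
elim: k m phi => [|k IHk] m phi mN.
  rewrite big_geq //=; case: m mN => [|m] _; rewrite ?mul0r ?mulr0 //.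
rewrite big_mkcond big_nat_recr //= -big_mkcond /=.
set c := fun s => lam k.+1 ^+ s / s`!%:R.
set phi_ := fun s y => phi (y + a k.+1 * s%:R).
have -> : \sum_(1 <= j < k.+1 | (j <= m)%N) j%:R * lam j *
     \sum_(0 <= s < N.+1 | (k.+1 * s <= m - j)%N)
       c s * csum lam a N k (m - j - k.+1 * s) (fun y => phi (y + a k.+1 * s%:R + a j))
  = \sum_(0 <= s < N.+1 | (k.+1 * s <= m)%N) c s *
      ((m - k.+1 * s)%:R * csum lam a N k (m - k.+1 * s) (phi_ s)).
  under eq_bigr do rewrite big_distrr /=.
  rewrite (exchange_big_dep_nat (fun s => (k.+1 * s <= m)%N)) /=; last by lia.
  apply: congr_big_nat => // s /andP[sm sN].
  rewrite IHk; last by lia.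
  rewrite big_distrr; apply: congr_big_nat => // j /=; first by lia.
  move=> /andP[/andP[jm jsm] _]; rewrite mulrCA !mulrA; congr (_ * _).
  have -> : (m - j - k.+1 * s = m - k.+1 * s - j)%N by lia.
  by congr csum; apply/funext => y; rewrite /phi_ addrAC.
have -> : (if (k < m)%N then k.+1%:R * lam k.+1 *
     \sum_(0 <= s < N.+1 | (k.+1 * s <= m - k.+1)%N)
       c s * csum lam a N k (m - k.+1 - k.+1 * s) (fun y => phi (y + a k.+1 * s%:R + a k.+1)) else 0)
  = \sum_(0 <= s < N.+1 | (k.+1 * s <= m)%N) c s *
      ((k.+1 * s)%:R * csum lam a N k (m - k.+1 * s) (phi_ s)).
  rewrite [RHS]big_mkcond big_nat_recl //= muln0 !mul0r mulr0 add0r -big_mkcond /=.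
  case: ltnP => km; last by rewrite big1_seq //= => s; lia.
  rewrite big_mkcond big_nat_recr //= -big_mkcond /=.
  (* Lowering [s] by one leaves [s = N] unmatched on the left, but that term is excluded: [m <= N]
     rules out [k.+1 * N <= m - k.+1]. *)
  rewrite ifF ?addr0; last by apply/negbTE; nia.
  rewrite big_distrr; apply: congr_big_nat => // s /=; first by lia.
  move=> _; have -> : (m - k.+1 - k.+1 * s = m - k.+1 * s.+1)%N by lia.
  set X := csum _ _ _ _ _ _; have -> : X = csum lam a N k (m - k.+1 * s.+1) (phi_ s.+1).
    by congr csum; apply/funext => y; rewrite /phi_ -natr1; congr phi; ring.
  rewrite /c factS exprS !natrM; field.
  by rewrite pnatr_eq0 -lt0n fact_gt0 /= addrC natr1 pnatr_eq0.
rewrite -big_split big_distrr; apply: congr_big_nat => // s /= /andP[sm _].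
rewrite -mulrDr -mulrDl -natrD subnK // /c; ring.
Qed.

Lemma csum0 lam a N k phi : csum lam a N k 0 phi = phi 0.
Proof.
elim: k phi => [|k IHk] phi /=; first by rewrite mul1r.
rewrite big_mkcond big_nat_recl //= muln0 leqnn fact0 expr0 divr1 mul1r sub0n IHk.
by rewrite big1_seq ?addr0 ?mulr0 ?add0r // => s _; rewrite mulnS.
Qed.

Lemma csum_rec_full lam a N k m phi : (m <= N)%N -> (m <= k)%N ->
  m%:R * csum lam a N k m phi =
  \sum_(1 <= j < m.+1) j%:R * lam j * csum lam a N k (m - j) (fun y => phi (y + a j)).
Proof.
move=> mN mk; rewrite csum_rec // (@big_cat_nat _ _ _ m.+1) //=.
rewrite [X in _ + X]big1_seq ?addr0; last first.
  by move=> j; rewrite mem_index_iota; lia.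
by apply: congr_big_nat => // j; lia.
Qed.

(** For positive [m] within both truncations, [csum_rec_full] determines the value from smaller
    totals, with coefficients free of [N] and [k]; strong induction concludes. *)
Lemma csum_indep lam a N k N' k' m phi :
    (m <= N)%N -> (m <= k)%N -> (m <= N')%N -> (m <= k')%N ->
  csum lam a N k m phi = csum lam a N' k' m phi.
Proof.
elim/ltn_ind: m phi => -[|m] IHm phi mN mk mN' mk'; first by rewrite !csum0.
apply: (@mulfI _ m.+1%:R); first by rewrite pnatr_eq0.
rewrite !csum_rec_full //; apply: eq_big_nat => j jm.
by rewrite IHm //; lia.
Qed.

Lemma csumD lam a N k m phi psi :
  csum lam a N k m (fun y => phi y + psi y) = csum lam a N k m phi + csum lam a N k m psi.
Proof.
elim: k m phi psi => [|k IHk] m phi psi /=; first by rewrite mulrDr.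
by rewrite -big_split; apply: eq_bigr => s _ /=; rewrite -mulrDr IHk.
Qed.

Lemma csumZ lam a N k m c phi :
  csum lam a N k m (fun y => c * phi y) = c * csum lam a N k m phi.
Proof.
elim: k m phi => [|k IHk] m phi /=; first by rewrite mulrCA.
by rewrite big_distrr; apply: eq_bigr => s _; rewrite IHk mulrCA.
Qed.

Lemma csum_ge0 lam a N k m phi : (forall j, 0 <= lam j) -> (forall y, 0 <= phi y) ->
  0 <= csum lam a N k m phi.
Proof.
move=> lam0; elim: k m phi => [|k IHk] m phi phi0 /=; first by rewrite mulr_ge0.
by apply: sumr_ge0 => s _; rewrite !mulr_ge0 ?exprn_ge0 ?invr_ge0 ?IHk.
Qed.

Lemma ler_csum lam a N k m phi psi : (forall j, 0 <= lam j) ->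
  (forall y, phi y <= psi y) -> csum lam a N k m phi <= csum lam a N k m psi.
Proof.
move=> lam0 le_pp; rewrite -subr_ge0 -mulN1r -csumZ -csumD; apply: csum_ge0 => // y.
by rewrite mulN1r subr_ge0.
Qed.

(** Exponential tilting: a count vector of total size [m] collects exactly the factor [rho ^+ m].
    This allows Poisson means of the form lambda_j rho^j, to which the growth hypotheses apply. *)
Lemma csum_scale lam rho a N k m phi :
  csum (fun j => lam j * rho ^+ j) a N k m phi = rho ^+ m * csum lam a N k m phi.
Proof.
elim: k m phi => [|k IHk] m phi /=; first by case: m => [|m]; rewrite ?mul1r //= !mul0r mulr0.
rewrite big_distrr; apply: eq_bigr => s sm /=; rewrite IHk exprMn -exprM.
have -> : rho ^+ m = rho ^+ (k.+1 * s) * rho ^+ (m - k.+1 * s) by rewrite -exprD subnKC.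
ring.
Qed.

(** This is the identity s lambda^s / s! = lambda lambda^(s-1) / (s-1)! applied to each term of y =
    sum_j a_j s_j. It is derived from the size recursion: after multiplication by the total [m], the
    induction hypothesis contributes the factor m - j and the shift by [a j] contributes j. *)
Lemma csum_mulr lam a N k m phi : (m <= N)%N -> (m <= k)%N ->
  csum lam a N k m (fun y => y * phi y) =
  \sum_(1 <= j < m.+1) a j * lam j * csum lam a N k (m - j) (fun y => phi (y + a j)).
Proof.
elim/ltn_ind: m phi => -[|m] IHm phi mN mk; first by rewrite csum0 mul0r big_geq.
apply: (@mulfI _ m.+1%:R); first by rewrite pnatr_eq0.
rewrite csum_rec_full //.
under eq_bigr => j _.
  have -> : (fun y => (y + a j) * phi (y + a j)) =
    (fun y => y * (fun z => phi (z + a j)) y + a j * phi (y + a j)).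
    by apply/funext => y; rewrite mulrDl.
  rewrite csumD csumZ mulrDr; over.
rewrite big_split /=.
have -> : \sum_(1 <= j < m.+2) j%:R * lam j *
    csum lam a N k (m.+1 - j) (fun y => y * phi (y + a j)) =
  \sum_(1 <= i < m.+2) a i * lam i *
    ((m.+1 - i)%:R * csum lam a N k (m.+1 - i) (fun y => phi (y + a i))).
  (* Expand by the induction hypothesis at [m.+1 - j], swap the sums over i and j, then fold the sum
     over j back by the recursion at [m.+1 - i]. *)
  transitivity (\sum_(1 <= j < m.+2) \sum_(1 <= i < m.+2 | (i + j <= m.+1)%N)
     j%:R * lam j * (a i * lam i * csum lam a N k (m.+1 - j - i) (fun y => phi (y + a i + a j)))).
    apply: eq_big_nat => j jm.
    rewrite (IHm (m.+1 - j)%N _ (fun z => phi (z + a j))); [|lia..].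
    rewrite big_distrr /= [RHS]big_mkcond [RHS](@big_cat_nat _ _ _ (m.+1 - j).+1) /=; [|lia..].
    rewrite [X in _ + X]big1_seq ?addr0; last first.
      by move=> i; rewrite mem_index_iota => ?; rewrite ifF //; lia.
    by apply: eq_big_nat => i ?; rewrite ifT //; lia.
  rewrite (exchange_big_dep_nat predT) //=; apply: eq_big_nat => i im.
  rewrite csum_rec_full; [|lia..].
  rewrite big_distrr /= [LHS]big_mkcond [LHS](@big_cat_nat _ _ _ (m.+1 - i).+1) /=; [|lia..].
  rewrite [X in _ + X]big1_seq ?addr0; last first.
    by move=> j; rewrite mem_index_iota => ?; rewrite ifF //; lia.
  apply: eq_big_nat => j ?; rewrite ifT; last by lia.
  rewrite mulrCA !mulrA; congr (_ * _).
  have -> : (m.+1 - j - i = m.+1 - i - j)%N by lia.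
  by congr csum; apply/funext => y; rewrite addrAC.
rewrite -big_split big_distrr; apply: eq_big_nat => j /= jm.
rewrite natrB; last by lia.
ring.
Qed.

(** * Second moments of independent Poisson variables *)

(** For xi Poisson of mean x, the variable c + b (xi - x) has mean c and variance b^2 x, so the full
    series equals the right-hand side; its terms are nonnegative, hence partial sums stay below. *)
Lemma poisson_moment (x c b : R) n : 0 <= x ->
  \sum_(0 <= s < n) x ^+ s / s`!%:R * (c + b * (s%:R - x)) ^+ 2
    <= expR x * (c ^+ 2 + b ^+ 2 * x).
Proof.
move=> x0; pose S n := \sum_(0 <= s < n) x ^+ s / s`!%:R * (c + b * (s%:R - x)) ^+ 2.
pose P := series (exp_coeff x).
(* s^2 = s(s-1) + s turns the sum into shifted partial sums of exp. *)
have SE m : S m.+2 = (c - b * x) ^+ 2 * P m.+2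
    + (2 * (c - b * x) * b + b ^+ 2) * x * P m.+1 + b ^+ 2 * x ^+ 2 * P m.
  elim: m => [|m IHm].
    rewrite /S /P /series /= !big_nat_recr //= !big_geq //= /exp_coeff /=.
    rewrite fact0 (_ : 1`! = 1%N) // !divr1 expr0 expr1; ring.
  have PS i : P i.+1 = P i + x ^+ i / i`!%:R by rewrite /P /series /= big_nat_recr.
  rewrite /S big_nat_recr //= -/(S _) IHm !PS !factS !exprS !natrM -!natr1.
  by field; rewrite pnatr_eq0 -lt0n fact_gt0 !natr1 !pnatr_eq0.
have cvP : P n @[n --> \oo] --> expR x by exact: is_cvg_series_exp_coeff.
have cvS : S n.+2 @[n --> \oo] --> expR x * (c ^+ 2 + b ^+ 2 * x).
  have -> : expR x * (c ^+ 2 + b ^+ 2 * x) = (c - b * x) ^+ 2 * expR x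
    + (2 * (c - b * x) * b + b ^+ 2) * x * expR x + b ^+ 2 * x ^+ 2 * expR x by ring.
  under eq_fun do rewrite SE.
  have cvM c' i : c' * P (i + n)%N @[n --> \oo] --> c' * expR x.
    apply: cvgM; first exact: cvg_cst.
    by under eq_fun do rewrite addnC; move: cvP; rewrite -(cvg_shiftn i).
  by apply: cvgD; [apply: cvgD; [exact: (cvM _ 2) | exact: (cvM _ 1)] | exact: (cvM _ 0)].
have S_mono : {homo S : i j / (i <= j)%N >-> i <= j}.
  apply/nondecreasing_seqP => i; rewrite /S big_nat_recr //= lerDl.
  by rewrite mulr_ge0 ?sqr_ge0 // divr_ge0 // exprn_ge0.
rewrite -/(S n); apply: (le_trans (S_mono n n.+2 _)); first by rewrite 2?leqW.
rewrite -(cvg_lim _ cvS) //.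
apply: (nondecreasing_cvgn_le (u_ := fun n => S n.+2)); last by apply/cvg_ex; eexists; exact: cvS.
by move=> i j ij; apply: S_mono; rewrite !ltnS.
Qed.

Lemma ler_sum_shift (f : nat -> R) t M : (forall i, 0 <= f i) ->
  \sum_(0 <= m < M | (t <= m)%N) f (m - t)%N <= \sum_(0 <= m < M) f m.
Proof.
move=> f0; have [tM|Mt] := leqP t M; last first.
  by rewrite big1_seq ?sumr_ge0 // => m; rewrite mem_index_iota; lia.
rewrite big_mkcond (@big_cat_nat _ _ _ t) //= big1_seq ?add0r; last first.
  by move=> m; rewrite mem_index_iota => mt; rewrite ifF //; lia.
rewrite -{1}(add0n t) big_addn (@big_cat_nat _ _ _ (M - t) 0 M) ?leq_subr //=.
rewrite -[leLHS]addr0 lerD ?sumr_ge0 //.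
by under eq_bigr do rewrite leq_addl addnK.
Qed.

(** Summing over all totals removes the conditioning, leaving a second moment of independent Poisson
    variables. The offset [c] is general so that the induction on [k] can absorb the centred
    contribution of the last variable into it. *)
Lemma sum_csum_sqr lam a N k M c : (forall j, 0 <= lam j) ->
  \sum_(0 <= m < M)
     csum lam a N k m (fun y => (c + y - \sum_(1 <= j < k.+1) a j * lam j) ^+ 2)
  <= expR (\sum_(1 <= j < k.+1) lam j) * (c ^+ 2 + \sum_(1 <= j < k.+1) lam j * a j ^+ 2).
Proof.
move=> lam0; elim: k c => [|k IHk] c.
  rewrite !(@big_geq _ _ _ 1 1) // expR0 mul1r addr0 /=.
  case: M => [|M]; first by rewrite big_geq ?sqr_ge0.
  rewrite addr0 subr0.
  by rewrite big_nat_recl //= mul1r big1 ?addr0 // => m _; rewrite mul0r.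
set A := \sum_(1 <= j < k.+1) a j * lam j in IHk.
set L := \sum_(1 <= j < k.+1) lam j in IHk.
set B := \sum_(1 <= j < k.+1) lam j * a j ^+ 2 in IHk.
rewrite !(big_nat_recr k.+1) //= -/A -/B -/L.
rewrite (exchange_big_dep_nat predT) //=.
set x := lam k.+1; set b := a k.+1.
pose w s := x ^+ s / s`!%:R; have w0 s : 0 <= w s by rewrite divr_ge0 ?exprn_ge0 ?lam0.
apply: (@le_trans _ _ (\sum_(0 <= s < N.+1)
    w s * (expR L * ((c + b * (s%:R - x)) ^+ 2 + B)))).
  apply: ler_sum => s _; rewrite -big_distrr /= ler_wpM2l //; first exact: w0.
  apply: (le_trans _ (IHk (c+b*(s%:R-x)))); pose f m := csum lam a N k m (fun y => (c + b * (s%:R - x) + y - A) ^+ 2).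
  rewrite -[leRHS]/(\sum_(0 <= i < M) f i).
  apply: (le_trans _ (ler_sum_shift f (k.+1 * s) M _)); last first.
    by move=> i; apply: csum_ge0 => // y; rewrite sqr_ge0.
  rewrite le_eqVlt; apply/orP; left; apply/eqP; apply: eq_bigr => m _; rewrite /f.
  by congr csum; apply/funext => y; congr (_ ^+ 2); ring.
(* The two summands match two uses of [poisson_moment]: one for the last variable, and one with c =
   1, b = 0 that only bounds its total mass by e^x. *)
have -> : expR (L + x) * (c ^+ 2 + (B + x * b ^+ 2)) =
   expR L * (expR x * (c ^+ 2 + b ^+ 2 * x)) + expR L * B * (expR x * (1 ^+ 2 + 0 ^+ 2 * x)).
  by rewrite expRD; ring.
have B0 : 0 <= B by apply: sumr_ge0 => j _; rewrite mulr_ge0 ?sqr_ge0.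
clearbody B.
apply: (@le_trans _ _ (expR L * \sum_(0 <= s < N.+1) w s * (c + b * (s%:R - x)) ^+ 2
   + expR L * B * \sum_(0 <= s < N.+1) w s * (1 + 0 * (s%:R - x)) ^+ 2)).
  rewrite !big_distrr -big_split /=; apply: ler_sum => s _.
  by rewrite le_eqVlt; apply/orP; left; apply/eqP; ring.
by apply: lerD; rewrite ler_wpM2l ?mulr_ge0 ?expR_ge0 ?poisson_moment //; exact: lam0.
Qed.

(* This is Q(m); see QE. *)
Definition cweight lam m : R := csum lam (fun=> 0) m m m (fun=> 1).

(** * Conditioned second moments for large and for small component sizes *)

Lemma csum_cst lam a b N k m c :
  csum lam a N k m (fun=> c) = csum lam b N k m (fun=> c).
Proof.
by elim: k m => [|k IHk] m //=; apply: eq_bigr => s _; rewrite IHk.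
Qed.

Lemma csum1 lam a N k m : (m <= N)%N -> (m <= k)%N ->
  csum lam a N k m (fun=> 1) = cweight lam m.
Proof. by move=> mN mk; rewrite (csum_indep _ _ _ _ m m) // (csum_cst _ _ (fun=> 0)). Qed.

(** Apply [csum_mulr] twice. After a component of size j > n/2 is removed, the remaining total is
    below n/2, where [a] vanishes, so the cross terms disappear. *)
Lemma csum_sqr_large lam a n : (forall j, (j.*2 <= n)%N -> a j = 0) ->
  csum lam a n n n (fun y => y ^+ 2) =
  \sum_(1 <= j < n.+1) lam j * a j ^+ 2 * cweight lam (n - j).
Proof.
move=> a0; rewrite [LHS](csum_mulr _ _ _ _ _ id) //; apply: eq_big_nat => j jn.
have [jn2|jn2] := leqP j.*2 n; first by rewrite a0 // expr0n /= !(mul0r, mulr0).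
have -> : (fun y => y + a j) = (fun y => y * (fun=> 1) y + a j * (fun=> 1) y).
  by apply/funext => y; rewrite !mulr1.
rewrite csumD csumZ csum1; [|lia..].
rewrite csum_mulr; [|lia..].
rewrite big1_seq; first by rewrite add0r; ring.
by move=> i; rewrite mem_index_iota => ?; rewrite a0 ?mul0r //; lia.
Qed.

Lemma csum_sqr_small lam a n (Theta theta : R) :
    0 < theta -> (forall j, 0 <= lam j) ->
    (forall j, (0 < j)%N -> j%:R * lam j <= Theta) ->
    (forall m, (0 < m)%N ->
      theta * expR (\sum_(1 <= j < m.+1) lam j) <= m%:R * cweight lam m) ->
    (0 < n)%N -> (forall j, (n < j.*2)%N -> a j = 0) ->
  csum lam a n n n (fun y => (y - \sum_(1 <= j < n.+1) a j * lam j) ^+ 2)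
  <= (2 * Theta * expR Theta / theta + 2) *
     \sum_(1 <= j < n.+1) lam j * a j ^+ 2 * cweight lam (n - j).
Proof.
move=> theta0 lam0 lamT lower n0 a0; set A := \sum_(_ <= _ < _) _.
set S := \sum_(_ <= _ < _) _.
set L := fun m => \sum_(1 <= j < m.+1) lam j in lower.
have Theta0 : 0 <= Theta by apply: le_trans (lamT 1 isT); rewrite mulr_ge0.
have q0 m : 0 <= cweight lam m by apply: csum_ge0.
(* There are j indices i in the range n - j < i <= n, each larger than j because 2j <= n, so each
   satisfies lambda_i <= Theta / j. *)
have L_diff j : (0 < j)%N -> (j.*2 <= n)%N -> L n <= Theta + L (n - j)%N.
  move=> j0 jn; rewrite /L (@big_cat_nat _ _ _ (n - j).+1) //=; last by lia.
  rewrite addrC lerD2r.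
  apply: (@le_trans _ _ (\sum_((n - j).+1 <= i < n.+1) Theta / j%:R)).
    rewrite big_seq [leRHS]big_seq; apply: ler_sum => i; rewrite mem_index_iota => ij.
    rewrite ler_pdivlMr ?ltr0n // mulrC; apply: le_trans (lamT i _); last by lia.
    by rewrite ler_wpM2r // ler_nat; lia.
  rewrite sumr_const_nat (_ : (n.+1 - (n - j).+1 = j)%N); last by lia.
  by rewrite -[leLHS]mulr_natr divfK // pnatr_eq0; lia.
(* Use the lower bound at n - j, which is positive, together with n - j <= n. *)
have expL j : (0 < j)%N -> (j.*2 <= n)%N ->
    expR (L n) <= n%:R * (expR Theta / theta) * cweight lam (n - j).
  move=> j0 jn; have := lower (n - j)%N; rewrite -/(L _) => /(_ ltac:(lia)) low.
  apply: (@le_trans _ _ (expR Theta * expR (L (n - j)%N))).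
    by rewrite -expRD ler_expR L_diff.
  have -> : n%:R * (expR Theta / theta) * cweight lam (n - j) =
    expR Theta * (n%:R * cweight lam (n - j) / theta) by ring.
  rewrite ler_wpM2l ?expR_ge0 // ler_pdivlMr // mulrC (le_trans low) //.
  by rewrite ler_wpM2r // ler_nat leq_subr.
have w0 j : 0 <= lam j * a j ^+ 2 by exact: mulr_ge0 (lam0 j) (sqr_ge0 _).
have n0' : 0 < n%:R :> R by rewrite ltr0n.
rewrite -(ler_pM2l n0') csum_rec_full //.
set B := \sum_(1 <= j < n.+1) lam j * a j ^+ 2.
have BS : expR (L n) * B <= n%:R * (expR Theta / theta) * S.
  rewrite /B /S !mulr_sumr big_seq [leRHS]big_seq.
  apply: ler_sum => j; rewrite mem_index_iota => jn.
  have [jn2|jn2] := leqP j.*2 n; last by rewrite a0 // expr0n /= !(mul0r, mulr0).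
  rewrite mulrC [leRHS]mulrCA ler_wpM2l ?w0 ?expL //; lia.
(* Both factors 2 come from (y + a_j - A)^2 <= 2 (y - A)^2 + 2 a_j^2. The first part is then bounded
   with j lambda_j <= Theta, the second with j <= n. *)
apply: (@le_trans _ _ (2 * Theta * (expR (L n) * B) + 2 * n%:R * S)); last first.
  apply: (@le_trans _ _ (2 * Theta * (n%:R * (expR Theta / theta) * S) + 2 * n%:R * S)).
    by rewrite lerD2r ler_wpM2l // mulr_ge0.
  by rewrite le_eqVlt; apply/orP; left; apply/eqP; ring.
(* The centre [A] is the same for every total [m]; this makes [sum_csum_sqr] applicable to the sum
   of the [f m]. *)
pose f m := csum lam a n n m (fun y => (0 + y - A) ^+ 2).
have f0 m : 0 <= f m by apply: csum_ge0 => // y; exact: sqr_ge0.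
have fB : \sum_(1 <= j < n.+1) f (n - j)%N <= expR (L n) * B.
  have := sum_csum_sqr lam a n n n 0 lam0; rewrite expr0n add0r => /(le_trans _) -> //.
  rewrite big_add1 /= big_nat_rev /= add0n le_eqVlt; apply/orP; left; apply/eqP.
  by apply: eq_big_nat => i ?; congr f; lia.
apply: (@le_trans _ _ (2 * Theta * \sum_(1 <= j < n.+1) f (n - j)%N + 2 * n%:R * S)); last first.
  by rewrite lerD2r ler_wpM2l // mulr_ge0.
rewrite !mulr_sumr -big_split /= big_seq [leRHS]big_seq.
apply: ler_sum => j; rewrite mem_index_iota => jn.
apply: (@le_trans _ _ (j%:R * lam j * (2 * f (n - j)%N + 2 * a j ^+ 2 * cweight lam (n - j)))).
  rewrite ler_wpM2l ?mulr_ge0 // -(csum1 lam a n n); [|lia..].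
  rewrite /f -!csumZ -csumD; apply: ler_csum => // y.
  have := sqr_ge0 (y - A - a j); nra.
rewrite mulrDr; apply: lerD.
  by rewrite mulrCA [leRHS]mulrAC -mulrA ler_wpM2l // mulrC ler_wpM2l ?lamT //; lia.
have -> : j%:R * lam j * (2 * a j ^+ 2 * cweight lam (n - j)) =
  2 * (lam j * a j ^+ 2 * cweight lam (n - j)) * j%:R by ring.
have -> : 2 * n%:R * (lam j * a j ^+ 2 * cweight lam (n - j)) =
  2 * (lam j * a j ^+ 2 * cweight lam (n - j)) * n%:R by ring.
apply: ler_wpM2l; last by rewrite ler_nat; lia.
by apply: mulr_ge0 => //; exact: mulr_ge0.
Qed.

End CountSums.

(** * From count vectors to generating polynomials and set partitions *)

Section Assemblies.
Local Open Scope ring_scope.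
Variable (R : realType).
Implicit Types (lam a : nat -> R) (phi : R -> R).

(** A product of truncated exponential series. Expanding it by distributivity yields the sum over
    finite functions that defines Q, which is how [cweightE] uses it. *)
Lemma coef_csum lam N k m :
  (\prod_(i < k) \sum_(s < N.+1) (lam i.+1 ^+ s / s`!%:R) *: 'X^(i.+1 * s))`_m
  = csum R lam (fun=> 0) N k m (fun=> 1).
Proof.
elim: k m => [|k IHk] m; first by rewrite big_ord0 coef1 /= mulr1.
rewrite big_ord_recr /= mulr_sumr coef_sum big_mkord [RHS]big_mkcond.
apply: eq_bigr => s _; rewrite -scalerAr coefZ coefMXn ltnNge.
by case: leqP => _; rewrite /= ?mulr0 // IHk.
Qed.

Lemma cweightE lam n :
  \sum_(s : {ffun 'I_n -> 'I_n.+1} | ell n s == n)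
     \prod_(i < n) (lam i.+1 ^+ s i / (s i)`!%:R) = cweight R lam n.
Proof.
rewrite /cweight -coef_csum bigA_distr_bigA /= coef_sum big_mkcond.
apply: eq_bigr => s _; rewrite [in RHS]scaler_prod prodrXr coefZ coefXn eq_sym.
by case: eqP; rewrite ?mulr1 ?mulr0.
Qed.

Section Partitions.
Variable T : finType.
Implicit Types (B D : {set T}) (P : {set {set T}}).

(** Removing B is a bijection, with inverse [B |: P]: a nonempty B cannot be a block of a partition
    of [D :\: B]. *)
Lemma sum_partition_block (F : {set {set T}} -> R) B D :
    B != set0 -> B \subset D ->
  \sum_(P | partition P D && (B \in P)) F P =
  \sum_(P | partition P (D :\: B)) F (B |: P).
Proof.
move=> B0 BD; rewrite (reindex_onto (fun P : {set {set T}} => B |: P) (fun P => P :\ B)) /=; last first.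
  by move=> P /andP[_ BP]; rewrite setD1K.
apply: eq_bigl => P; rewrite setU11 andbT; apply/andP/idP => [[PD /eqP <-]|PDB].
  by apply: partitionD1; rewrite ?setU11.
split; last first.
  apply/eqP/setU1K; apply/negP => /(partitionS PDB).
  by rewrite subsetD -setI_eq0 setIid (negPf B0) andbF.
rewrite -(setID D B) (setIidPr BD).
by apply: partitionU1 => //; rewrite disjoint_sym disjoints_subset setDE subsetIr.
Qed.

Lemma sum_subset_card (G : nat -> R) D :
  \sum_(B : {set T} | (B != set0) && (B \subset D)) G #|B| =
  \sum_(1 <= j < #|D|.+1) 'C(#|D|, j)%:R * G j.
Proof.
transitivity (\sum_(B : {set T} | B \subset D) \sum_(1 <= j < #|D|.+1 | #|B| == j) G j).
  rewrite big_mkcondl; apply: eq_bigr => B BD.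
  rewrite -cards_eq0; have := subset_leq_card BD; case: #|B| => [|b] bD /=.
    by rewrite big1_seq // => j /andP[/eqP <-]; rewrite mem_index_iota.
  rewrite big_mkcond (bigD1_seq b.+1) ?iota_uniq ?mem_index_iota //= eqxx.
  by rewrite big1 ?addr0 // => j /negPf; rewrite eq_sym => ->.
rewrite (exchange_big_dep predT) //=; apply: eq_bigr => j _.
rewrite sumr_const -(cards_draws D j) mulr_natl; congr (_ *+ _).
by apply: eq_card => B; rewrite !inE.
Qed.

(** A weighted exponential formula. It is stated for arbitrary [D] and [phi] because deleting a
    block shrinks [D] and shifts the argument of [phi]. *)
Lemma sum_partition (g : nat -> nat) a phi D N k : (#|D| <= N)%N -> (#|D| <= k)%N ->
  \sum_(P | partition P D) (\prod_(B in P) (g #|B|)%:R) * phi (\sum_(B in P) a #|B|) =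
  #|D|`!%:R * csum R (fun j => (g j)%:R / j`!%:R) a N k #|D| phi.
Proof.
have [d] := ubnP #|D|; elim: d D phi => // d IHd D phi.
have [-> _ _ _|D0] := eqVneq D set0.
  rewrite (big_pred1 set0); last by move=> P; rewrite /= partition_set0.
  by rewrite !big_set0 cards0 csum0 fact0.
rewrite ltnS => Dd DN Dk; have cD0 : (0 < #|D|)%N by rewrite card_gt0.
(* Double counting: #|D| is the sum of the block sizes, and removing a block B
   leaves a partition of D :\: B. *)
apply: (@mulfI _ #|D|%:R); first by rewrite pnatr_eq0 -lt0n.
rewrite [RHS]mulrCA csum_rec_full //.
pose W P : R := (\prod_(B in P) (g #|B|)%:R) * phi (\sum_(B in P) a #|B|).
transitivity (\sum_(P | partition P D) \sum_(B in P) #|B|%:R * W P).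
  rewrite mulr_sumr; apply: eq_bigr => P PD.
  by rewrite -mulr_suml (card_partition PD) natr_sum.
rewrite (exchange_big_dep (fun B => (B != set0) && (B \subset D))) /=; last first.
  by move=> P B PD BP; rewrite (partitionS PD BP) (partition_neq0 PD BP).
pose G j := j%:R * (g j)%:R * ((#|D| - j)`!%:R *
  csum R (fun j => (g j)%:R / j`!%:R) a N k (#|D| - j) (fun y => phi (y + a j))).
transitivity (\sum_(B : {set T} | (B != set0) && (B \subset D)) G #|B|).
  apply: eq_bigr => B /andP[B0 BD].
  have cB0 : (0 < #|B|)%N by rewrite card_gt0.
  rewrite -mulr_sumr sum_partition_block // /G -mulrA; congr (_ * _).
  have cDB : #|D :\: B| = (#|D| - #|B|)%N by rewrite cardsD (setIidPr BD).
  rewrite -cDB -(IHd (D :\: B) (fun y => phi (y + a #|B|))); [|lia..].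
  rewrite mulr_sumr; apply: eq_bigr => P PDB.
  have BP : B \notin P.
    apply/negP => /(partitionS PDB).
    by rewrite subsetD -setI_eq0 setIid (negPf B0) andbF.
  by rewrite /W !big_setU1 //= -mulrA addrC.
rewrite sum_subset_card mulr_sumr; apply: eq_big_nat => j jD.
(* The binomial counting the blocks of size j, times (d - j)!, is d! / j!; the 1 / j! turns g_j into
   lambda_j. *)
rewrite /G -(bin_fact (m := j) (n := #|D|)) ?natrM; last by lia.
by field; rewrite pnatr_eq0 -lt0n fact_gt0.
Qed.

End Partitions.
End Assemblies.

(** * Labelled assemblies, and translation of the stated definitions *)

Section Labels.
Local Open Scope ring_scope.

(** For a fixed partition the labels are chosen independently: g_|B| choices on a block, one on any
    other subset. *)
Lemma sum_is_assembly (R : realType) g n (H : {set {set 'I_n}} -> R) :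
  \sum_(x : raw_asm g n | is_assembly g n x) H x.1 =
  \sum_(P | partition P [set: 'I_n]) (\prod_(B in P) (g #|B|)%:R) * H P.
Proof.
pose ok (P : {set {set 'I_n}}) (B : {set 'I_n}) :=
  [pred y : 'I_(Kmax g n).+1 | if B \in P then (y < g #|B|)%N else (y == 0 :> nat)].
have card_ok P B : #|ok P B| = if B \in P then g #|B| else 1%N.
  have cB : (#|B| < n.+1)%N by rewrite ltnS -[n in leqRHS]card_ord max_card.
  (* A subset has at most n elements, so [Kmax] leaves room for all of its g_|B| labels. *)
  have gK : (g #|B| <= (Kmax g n).+1)%N.
    by rewrite leqW // (leq_bigmax (Ordinal cB)).
  rewrite -[LHS]sum1_card; case: ifPn => BP.
    transitivity (\sum_(i < g #|B|) 1)%N; last by rewrite sum1_card card_ord.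
    rewrite (big_ord_widen _ (fun=> 1%N) gK).
    by apply: eq_bigl => y; rewrite inE /= BP.
  by rewrite (big_pred1 ord0) // => y; rewrite inE /= (negPf BP).
transitivity (\sum_(P | partition P [set: 'I_n])
    \sum_(f | f \in family (ok P)) H P).
  rewrite pair_big_dep; apply: eq_bigl => -[P f] /=; rewrite /is_assembly /=.
  by congr (_ && _); apply/forallP/familyP.
apply: eq_bigr => P _; rewrite sumr_const -natr_prod mulr_natl; congr (_ *+ _).
rewrite card_family foldrE big_map big_enum [RHS]big_mkcond.
by apply: eq_bigr => B _; rewrite card_ok.
Qed.

Local Notation R := Rdefinitions.R.

Lemma sumRE (T : Type) (s : seq T) (f : T -> R) : sumR s f = \sum_(x <- s) f x.
Proof. by elim: s => [|x s IHs]; rewrite ?big_nil // big_cons -IHs. Qed.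

Lemma prodRE (T : Type) (s : seq T) (f : T -> R) : prodR s f = \prod_(x <- s) f x.
Proof. by elim: s => [|x s IHs]; rewrite ?big_nil // big_cons -IHs. Qed.

Lemma sum1nE n (F : nat -> R) : sum1n n F = \sum_(1 <= j < n.+1) F j.
Proof. by rewrite /sum1n sumRE /index_iota subn1. Qed.

Lemma lamE g j : lam g j = (g j)%:R / j`!%:R.
Proof. by rewrite /lam RdivE !INRE. Qed.

Lemma QE g n : Q g n = cweight R (lam g) n.
Proof.
rewrite /Q sumRE big_enum -cweightE; apply: eq_bigr => s _.
rewrite prodRE big_enum; apply: eq_bigr => i _.
by rewrite RdivE RpowE INRE.
Qed.

Lemma caddE g n a x : is_assembly g n x -> cadd g n a x = \sum_(B in x.1) a #|B|.
Proof.
move=> /andP[Px _]; rewrite /cadd sum1nE.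
under eq_bigr => j _.
  rewrite RmultE INRE mulr_natr -sumr_const; over.
rewrite (exchange_big_dep (fun B => B \in x.1)) /=; last first.
  by move=> j B _; rewrite inE => /andP[].
apply: eq_bigr => B BP; have cB : (0 < #|B|)%N by rewrite card_gt0 (partition_neq0 Px).
rewrite big_mkcond (bigD1_seq #|B|) ?iota_uniq ?mem_index_iota //=; last first.
  by rewrite cB ltnS -[n in leqRHS]card_ord max_card.
rewrite inE BP eqxx /= big1 ?addr0 // => j /negPf jB.
by rewrite inE eq_sym jB andbF.
Qed.

Lemma sum_Gn g n a (phi : R -> R) :
  \sum_(x <- Gn g n) phi (cadd g n a x) = n`!%:R * csum R (lam g) a n n n phi.
Proof.
rewrite /Gn big_enum.
rewrite (eq_bigr (fun x : raw_asm g n => phi (\sum_(B in x.1) a #|B|))); last first.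
  by move=> x; rewrite inE => /caddE ->.
rewrite (sum_is_assembly R g n (fun P => phi (\sum_(B in P) a #|B|))) /=.
rewrite (sum_partition R _ g a phi [set: 'I_n] n n) ?cardsT ?card_ord //.
have -> : lam g = (fun j => (g j)%:R / j`!%:R) by apply/funext => j; rewrite lamE.
by [].
Qed.

Lemma size_Gn g n : (size (Gn g n))%:R = n`!%:R * Q g n :> R.
Proof.
rewrite QE -(csum1 R _ (fun=> 0) n n) // -sum_Gn.
by rewrite big_const_seq count_predT iter_addr_0.
Qed.

(** The mean minimises the mean squared deviation: the two sides differ by (E - c)^2. Hence the
    Poisson mean may replace the exact conditioned mean as centre. *)
Lemma Vn_le g n h c : (0 < size (Gn g n))%N ->
  Vn g n h <= (size (Gn g n))%:R^-1 * \sum_(x <- Gn g n) (h x - c) ^+ 2.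
Proof.
move=> sG; rewrite /Vn RmultE RinvE INRE sumRE.
under eq_bigr => x _ do rewrite RpowE RminusE.
have s0 : (size (Gn g n))%:R != 0 :> R by rewrite pnatr_eq0 -lt0n.
rewrite ler_wpM2l ?invr_ge0 //.
have := erefl (En g n h); rewrite {2}/En RmultE RinvE INRE sumRE.
set E := En g n h => /(congr1 (fun y => (size (Gn g n))%:R * y)); rewrite mulVKf // => EE.
rewrite -subr_ge0 -sumrB.
have -> : \sum_(x <- Gn g n) ((h x - c) ^+ 2 - (h x - E) ^+ 2) =
   \sum_(x <- Gn g n) (2 * (E - c) * h x + (E - c) * (- c - E)).
  by apply: eq_bigr => x _; ring.
rewrite big_split /= -mulr_sumr -EE big_const_seq count_predT iter_addr_0 -[_ * _ *+ _]mulr_natl.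
have -> : forall m : R, 2 * (E - c) * (m * E) + m * ((E - c) * (- c - E)) = m * (E - c) ^+ 2.
  by move=> m; ring.
by rewrite mulr_ge0 ?sqr_ge0.
Qed.

End Labels.

(** * Assembling the variance bound *)

Section Variance.
Local Open Scope ring_scope.
Local Notation R := Rdefinitions.R.

Lemma variance_bound (rho Theta theta : R) g n (a : nat -> R) :
    0 < rho -> 0 < theta ->
    (forall j, (0 < j)%N -> rho ^+ j * j%:R * lam g j <= Theta) ->
    (forall m, (0 < m)%N ->
      theta * expR (\sum_(1 <= j < m.+1) lam g j * rho ^+ j) <= m%:R * Q g m * rho ^+ m) ->
    (0 < n)%N ->
  Vn g n (cadd g n a) <=
  (2 * (2 * Theta * expR Theta / theta + 2) + 2) *
    \sum_(1 <= j < n.+1) lam g j * a j ^+ 2 * (Q g (n - j) / Q g n).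
Proof.
move=> rho0 theta0 upper lower n0; set K := 2 * Theta * expR Theta / theta + 2.
pose lam' := fun j => lam g j * rho ^+ j.
have lam0 j : 0 <= lam g j by rewrite lamE divr_ge0.
have rho_ge0 i : 0 <= rho ^+ i by rewrite exprn_ge0 // ltW.
have lam'0 j : 0 <= lam' j by exact: mulr_ge0 (lam0 j) (rho_ge0 j).
have cw m : cweight R lam' m = rho ^+ m * Q g m by rewrite QE; exact: csum_scale.
have Q_ge0 m : 0 <= Q g m by rewrite QE; apply: csum_ge0.
have w0 j : 0 <= lam g j * a j ^+ 2 * Q g (n - j).
  exact: mulr_ge0 (mulr_ge0 (lam0 j) (sqr_ge0 _)) (Q_ge0 _).
have rhon0 : 0 < rho ^+ n by rewrite exprn_gt0.
(* Positivity comes from the lower bound, whose left side is a positive multiple of an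
   exponential. *)
have Qn0 : 0 < Q g n.
  have := lower n n0; rewrite mulrAC => /(lt_le_trans (mulr_gt0 theta0 (expR_gt0 _))).
  by rewrite pmulr_rgt0 // mulr_gt0 ?ltr0n.
pose a1 j := if (j.*2 <= n)%N then a j else 0.
pose a2 j := if (j.*2 <= n)%N then 0 else a j.
(* Only the small-size part is centred, at its mean under the tilted Poisson weights [lam']. *)
pose c : R := \sum_(1 <= j < n.+1) a1 j * lam' j.
have small : csum R (lam g) a1 n n n (fun y => (y - c) ^+ 2) <=
    K * \sum_(1 <= j < n.+1) lam g j * a j ^+ 2 * Q g (n - j).
  (* Pass to the tilted weights; afterwards rho^n = rho^j rho^(n-j) distributes over lambda_j and
     Q(n-j). *)
  rewrite -(ler_pM2l rhon0) -csum_scale -/lam'.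
  have := @csum_sqr_small R lam' a1 n Theta theta theta0 lam'0.
  rewrite -/c -/K => /(_ _ _ n0 _) /le_trans -> //.
  - move=> j j0; rewrite /lam' mulrA mulrC mulrA; exact: upper.
  - by move=> m m0; rewrite cw mulrA mulrAC; exact: lower.
  - by move=> j; rewrite /a1; case: leqP.
  have K0 : 0 <= K.
    have Theta0 : 0 <= Theta.
      by apply: le_trans (upper 1 isT); exact: mulr_ge0 (mulr_ge0 (rho_ge0 1) (ler0n _ 1)) (lam0 1).
    by rewrite /K addr_ge0 // divr_ge0 ?(ltW theta0) // mulr_ge0 ?expR_ge0 // mulr_ge0.
  rewrite mulrCA ler_wpM2l // mulr_sumr big_seq [leRHS]big_seq.
  apply: ler_sum => j; rewrite mem_index_iota ltnS => /andP[_ jn]; rewrite cw /lam' /a1.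
  have -> : rho ^+ n = rho ^+ j * rho ^+ (n - j) by rewrite -exprD subnKC.
  have X0 := mulr_ge0 (mulr_ge0 (rho_ge0 j) (rho_ge0 (n - j)%N)) (w0 j).
  case: leqP => _; last by rewrite expr0n !(mul0r, mulr0).
  by rewrite le_eqVlt; apply/orP; left; apply/eqP; ring.
have large : csum R (lam g) a2 n n n (fun y => y ^+ 2) <=
    \sum_(1 <= j < n.+1) lam g j * a j ^+ 2 * Q g (n - j).
  rewrite csum_sqr_large; last by move=> j; rewrite /a2 => ->.
  apply: ler_sum => j _; rewrite -QE /a2.
  by case: ifP => // _; rewrite expr0n !(mul0r, mulr0).
have sG : (0 < size (Gn g n))%N.
  by rewrite -(ltr0n R) size_Gn mulr_gt0 // ltr0n fact_gt0.
apply: le_trans (Vn_le _ _ _ c sG) _.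
have h12 x : cadd g n a x = cadd g n a1 x + cadd g n a2 x.
  rewrite /cadd !sum1nE -big_split; apply: eq_bigr => j _ /=.
  by rewrite !RmultE -mulrDl /a1 /a2; case: ifP; rewrite ?addr0 ?add0r.
(* The inequality (u - c + v)^2 <= 2 (u - c)^2 + 2 v^2 separates small from large sizes, so the
   bounds K and 1 combine to 2 K + 2. *)
apply: (@le_trans _ _ ((size (Gn g n))%:R^-1 *
    \sum_(x <- Gn g n) (2 * (cadd g n a1 x - c) ^+ 2 + 2 * cadd g n a2 x ^+ 2))).
  rewrite ler_wpM2l ?invr_ge0 //; apply: ler_sum => x _; rewrite h12.
  move: (cadd g n a1 x) (cadd g n a2 x) => u v.
  have -> : 2 * (u - c) ^+ 2 + 2 * v ^+ 2 = (u + v - c) ^+ 2 + (u - c - v) ^+ 2 by ring.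
  by rewrite lerDl sqr_ge0.
rewrite big_split /= -!mulr_sumr.
rewrite (sum_Gn g n a1 (fun y => (y - c) ^+ 2)) (sum_Gn g n a2 (fun y => y ^+ 2)) size_Gn.
have -> : \sum_(1 <= j < n.+1) lam g j * a j ^+ 2 * (Q g (n - j) / Q g n) =
   (\sum_(1 <= j < n.+1) lam g j * a j ^+ 2 * Q g (n - j)) / Q g n.
  by rewrite mulr_suml; apply: eq_bigr => j _; rewrite mulrA.
set S := \sum_(_ <= _ < _) _ in small large *.
set X := csum _ _ _ _ _ _ _ in small *; set Y := csum _ _ _ _ _ _ _ in large *.
have nf0 : n`!%:R != 0 :> R by rewrite pnatr_eq0 -lt0n fact_gt0.
have -> : (n`!%:R * Q g n)^-1 * (2 * (n`!%:R * X) + 2 * (n`!%:R * Y)) = (2 * X + 2 * Y) / Q g n.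
  by field; rewrite nf0 gt_eqF.
rewrite mulrA ler_wpM2r ?invr_ge0 ?Q_ge0 //.
have -> : (2 * K + 2) * S = 2 * (K * S) + 2 * S by ring.
by apply: lerD; rewrite ler_wpM2l.
Qed.

End Variance.

Local Open Scope R_scope.

Theorem theorem2 :
  forall (rho Theta theta theta' : R) (n0 : nat),
    0 < rho -> 0 < Theta -> 0 < theta -> 0 < theta' -> (1 <= n0)%nat ->
    exists C : R, 0 < C /\
      forall (g : nat -> nat), weakly_log g rho Theta theta theta' n0 ->
      forall (n : nat) (a : nat -> R), (1 <= n)%nat ->
        Vn g n (cadd g n a) <=
        C * sum1n n (fun j => lam g j * a j ^ 2 * (Q g (n - j) / Q g n)).
Proof.
move=> rho Theta theta theta' n0 rho0 Theta0 _ theta'0 _.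
(* The constant of [variance_bound], with theta' from condition (iii) in the role of its [theta]. *)
exists (2 * (2 * Theta * exp Theta / theta' + 2) + 2); split.
  have : 0 < 2 * Theta * exp Theta / theta'.
    apply: Rdiv_lt_0_compat theta'0; apply: Rmult_lt_0_compat (exp_pos _); Lra.lra.
  Lra.lra.
move=> g [upper [_ lower]] n a n1; apply/RleP.
rewrite sum1nE RmultE !RplusE !RmultE RdivE RexpE.
under eq_bigr => j _ do rewrite !RmultE RpowE RdivE.
apply: (variance_bound rho Theta theta' g n a) => //.
- exact/RltP.
- exact/RltP.
- by move=> j j0; apply/RleP; rewrite -INRE -RpowE; exact: upper.
- move=> m m0; apply/RleP; have := Rge_le _ _ (lower m m0).
  rewrite sum1nE RexpE !RmultE INRE RpowE.
  by under eq_bigr => j _ do rewrite RmultE RpowE.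
Qed.
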